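(* Let $\mathcal{X}$ be a class of graphs. Then $\mathcal{X}$ is of structurally bounded degree if and only if $\mathcal{X}$ is a function of $\mathcal{C}\cup\mathcal{D}_1$.
   Context: All graphs are finite and simple; a class of graphs is a set of graphs closed under isomorphism. $\mathcal{C}$ is the class of graphs consisting of one clique together with isolated vertices; $\mathcal{D}_1$ is the class of graphs of maximum degree at most 1. A class is of structurally bounded degree if it is a first-order transduction of a class of graphs of bounded maximum degree. Here a class $\mathcal{Y}$ is a first-order transduction of a class $\mathcal{X}$ if there are constants $c,m$ and a first-order formula $\phi(x,y)$ (in the language of graphs expanded by the copy structure and $m$ unary predicates) such that every graph in $\mathcal{Y}$ is obtained from some $G\in\mathcal{X}$ by taking $c$ disjoint copies of $G$, coloring the vertices with $m$ colors (unary predicates), defining a new adjacency relation by $\phi$, and taking an induced subgraph. For a graph $G$ and distinct vertices $u,w$, $G(u,w)=1$ if they are adjacent and $0$ otherwise. If $G,H_1,\dots,H_k$ are graphs on the same vertex set $V$, $G$ is a (boolean) function of $H_1,\dots,H_k$ if there is a boolean function $f:\{0,1\}^k\to\{0,1\}$ with $G(a,b)=f(H_1(a,b),\dots,H_k(a,b))$ for all distinct $a,b\in V$. A class $\mathcal{Y}$ is a $k$-function of $\mathcal{X}$ if every $G\in\mathcal{Y}$ is a function of at most $k$ graphs from $\mathcal{X}$ (on the vertex set of $G$); $\mathcal{Y}$ is a function of $\mathcal{X}$ if it is a $k$-function for some $k\in\mathbb{N}$. *)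

(* Defs.v *)
From mathcomp Require Import all_boot.
Set Implicit Arguments.
Unset Strict Implicit.
Unset Printing Implicit Defensive.

Record sgraph (V : finType) := SGraph {
  adj : rel V;
  adj_sym : symmetric adj;
  adj_irr : irreflexive adj }.

Definition iso (V W : finType) (G : sgraph V) (H : sgraph W) : Prop :=
  exists2 f : V -> W, bijective f & forall u v, adj G u v = adj H (f u) (f v).

Definition induced_subgraph_of (V W : finType) (G : sgraph V) (H : sgraph W) : Prop :=
  exists2 f : V -> W, injective f & forall u v, adj G u v = adj H (f u) (f v).

(* The closure under isomorphism required of a class is the separate predicate
   [iso_closed]. *)
Definition graph_family := forall V : finType, sgraph V -> Prop.

Definition iso_closed (X : graph_family) : Prop :=
  forall (V W : finType) (G : sgraph V) (H : sgraph W), iso G H -> X V G -> X W H.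

Definition familyU (X Y : graph_family) : graph_family :=
  fun V G => X V G \/ Y V G.

Definition degree (V : finType) (G : sgraph V) (v : V) : nat := #|[set w | adj G v w]|.

Definition max_degree (V : finType) (G : sgraph V) : nat := \max_(v : V) degree G v.

Definition bounded_degree (X : graph_family) : Prop :=
  exists d : nat, forall (V : finType) (G : sgraph V), X V G -> max_degree G <= d.

Definition classC : graph_family := fun V G =>
  exists K : {set V}, forall u v, adj G u v = [&& u != v, u \in K & v \in K].

Definition classD1 : graph_family := fun V G => max_degree G <= 1.

(* [fo c m n]: first-order formulas with free variables among x_0, ..., x_(n-1)
   in the language of graphs expanded by the copy structure (the binary relation
   "copies of the same vertex" and the predicates "in copy number i", i < c) and
   by m unary predicates. A quantifier binds x_0 and shifts the other variables
   by one. *)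
Inductive fo (c m : nat) : nat -> Type :=
| FEq n (x y : 'I_n) : fo c m n
| FAdj n (x y : 'I_n) : fo c m n
| FSame n (x y : 'I_n) : fo c m n
| FCopy n (i : 'I_c) (x : 'I_n) : fo c m n
| FColor n (p : 'I_m) (x : 'I_n) : fo c m n
| FNot n (f : fo c m n) : fo c m n
| FAnd n (f g : fo c m n) : fo c m n
| FEx n (f : fo c m n.+1) : fo c m n.

(* Satisfaction in c disjoint copies of G, colored by P; (v, i) is the copy of v
   in copy number i. *)
Fixpoint sat (c m : nat) (V : finType) (G : sgraph V) (P : 'I_m -> {set V * 'I_c})
    (n : nat) (f : fo c m n) : n.-tuple (V * 'I_c)%type -> bool :=
  match f in fo _ _ n0 return n0.-tuple (V * 'I_c)%type -> bool with
  | FEq _ x y => fun e => tnth e x == tnth e y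
  | FAdj _ x y => fun e =>
      ((tnth e x).2 == (tnth e y).2) && adj G (tnth e x).1 (tnth e y).1
  | FSame _ x y => fun e => (tnth e x).1 == (tnth e y).1
  | FCopy _ i x => fun e => (tnth e x).2 == i
  | FColor _ p x => fun e => tnth e x \in P p
  | FNot _ g => fun e => ~~ sat G P g e
  | FAnd _ g h => fun e => sat G P g e && sat G P h e
  | FEx _ g => fun e => [exists a : V * 'I_c, sat G P g [tuple of a :: e]]
  end.

(* In [fo_transduction X Y], Y is a transduction of X: H is the graph on the
   copies of G whose adjacency relation is defined by phi(x_0, x_1). *)
Definition fo_transduction (X Y : graph_family) : Prop :=
  exists (c m : nat) (phi : fo c m 2),
  forall (W : finType) (G' : sgraph W), Y W G' ->
  exists (V : finType) (G : sgraph V) (P : 'I_m -> {set V * 'I_c})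
         (H : sgraph (V * 'I_c)%type),
    [/\ X V G,
        forall a b, adj H a b = sat G P phi [tuple a; b] &
        induced_subgraph_of G' H].

Definition structurally_bounded_degree (Y : graph_family) : Prop :=
  exists X : graph_family, [/\ iso_closed X, bounded_degree X & fo_transduction X Y].

Definition boolean_function_of (V : finType) (G : sgraph V) (k : nat)
    (H : 'I_k -> sgraph V) : Prop :=
  exists f : {ffun 'I_k -> bool} -> bool,
  forall a b : V, a != b -> adj G a b = f [ffun i => adj (H i) a b].

Definition k_function_of (k : nat) (Y X : graph_family) : Prop :=
  forall (V : finType) (G : sgraph V), Y V G ->
  exists2 l : nat, l <= k &
  exists2 H : 'I_l -> sgraph V, forall i, X V (H i) & boolean_function_of G H.

Definition function_of (Y X : graph_family) : Prop :=
  exists k : nat, k_function_of k Y X.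

(* Main.v *)
(** A graph of bounded degree splits into boundedly many matchings, that is,
    involutions of its vertex set, so the copies of the graph carry a bounded family
    of permutations expressing adjacency and "copies of the same vertex".  In one fixed
    structure of this kind, the truth of a formula at a tuple e depends only on colors
    of the e_i, from a bounded palette, and on which words g in the permutations satisfy
    g e_i = e_j: a quantifier is eliminated by counting color classes, as in Hanf's
    theorem.  Hence a transduction has its edges determined by the colors of the two
    ends, up to a correction of bounded degree; the former part is a function of cliques,
    the latter a union of matchings.  Conversely, matchings drawn on separate layers
    over the vertex set form a graph of bounded degree, from which a fixed formula
    recovers any boolean function of matchings and cliques. *)

Require Import Defs.
From mathcomp Require Import all_boot all_fingroup.

Set Implicit Arguments.
Unset Strict Implicit.
Unset Printing Implicit Defensive.

(** * Degrees, and images under maps with equal kernels *)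

Lemma max_degree_leP (V : finType) (G : sgraph V) (d : nat) :
  reflect (forall v, degree G v <= d) (max_degree G <= d).
Proof.
apply: (iffP idP) => [le_d v|le_d]; last by apply/bigmax_leqP.
exact: leq_trans (leq_bigmax v) le_d.
Qed.

Lemma iso_max_degree (V W : finType) (G : sgraph V) (H : sgraph W) (d : nat) :
  iso G H -> max_degree G <= d -> max_degree H <= d.
Proof.
case=> f [h hK fK] Hf /max_degree_leP le_d; apply/max_degree_leP => w.
apply: leq_trans (le_d (h w)).
rewrite /degree -(card_imset _ (can_inj hK)); apply/subset_leq_card/subsetP => w'.
rewrite inE => ww'; apply/imsetP; exists (h w'); last by rewrite fK.
by rewrite inE Hf !fK.
Qed.

Lemma degree_le1_inj (V : finType) (G : sgraph V) (u v w : V) :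
  max_degree G <= 1 -> adj G u v -> adj G u w -> v = w.
Proof.
move=> /max_degree_leP /(_ u) /card_le1_eqP Hu uv uw.
by apply/esym/Hu; rewrite inE.
Qed.

(** Equal kernels make [h x |-> h' x] a well-defined bijection between the images. By symmetry one
    inequality suffices. *)
Lemma card_imset_same_kernel (I A B : finType) (h : I -> A) (h' : I -> B)
    (D : {set I}) :
  (forall x y, (h x == h y) = (h' x == h' y)) -> #|h @: D| = #|h' @: D|.
Proof.
have le_card (A' B' : finType) (k : I -> A') (k' : I -> B') :
    (forall x y, (k x == k y) = (k' x == k' y)) -> #|k @: D| <= #|k' @: D|.
  move=> ker; have [->|[x0 _]] := set_0Vmem D; first by rewrite !imset0 !cards0.
  pose p z := k (odflt x0 [pick x in D | k' x == z]).
  apply: leq_trans (leq_imset_card p _); apply/subset_leq_card/subsetP => z.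
  case/imsetP=> x Dx ->; apply/imsetP; exists (k' x); first exact: imset_f.
  rewrite /p; case: pickP => [y /andP[_ /eqP Ey]|/(_ x)]; last by rewrite Dx eqxx.
  by apply/eqP; rewrite /= ker Ey.
by move=> ker; apply/eqP; rewrite eqn_leq !le_card // => x y; rewrite ker.
Qed.

(** * Edge colorings of graphs of bounded degree *)

(** Vertices are colored one at a time: [d] neighbors cannot use up [d.+1] colors. The relation may
    be reflexive, as the square of a graph is, hence the condition [v != w]. *)
Lemma greedy_coloring (V : finType) (r : rel V) (d : nat) :
  symmetric r -> (forall v, #|[set w | r v w]| <= d) ->
  exists kappa : V -> 'I_d.+1, forall v w, r v w -> v != w -> kappa v != kappa w.
Proof.
move=> r_sym le_d.
suff [kappa Hk] : exists kappa : V -> 'I_d.+1,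
    forall v w, v \in enum V -> w \in enum V -> r v w -> v != w -> kappa v != kappa w.
  by exists kappa => v w; apply: Hk; rewrite mem_enum.
elim: (enum V) => [|x s [kappa Hk]]; first by exists (fun=> ord0).
have [i Hi] : exists i, i \notin kappa @: [set w | r x w].
  case: (pickP [pred i | i \notin kappa @: [set w | r x w]]) => [i Hi|Hall].
    by exists i.
  suff : #|'I_d.+1| <= d by rewrite card_ord ltnn.
  apply: leq_trans (le_d x); apply: leq_trans (leq_imset_card kappa _).
  by apply/subset_leq_card/subsetP => i _; move/negbFE: (Hall i).
have Hi' w : r x w -> i != kappa w.
  by move=> xw; apply: contraNneq Hi => ->; apply: imset_f; rewrite inE.
exists (fun v => if v == x then i else kappa v) => v w.
rewrite !inE; case: eqP => [->|_] /=; case: eqP => [->|_] //=.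
- by rewrite eqxx.
- by move=> _ _ /Hi' ->.
- by move=> _ _ vx _; rewrite eq_sym Hi' // r_sym.
- exact: Hk.
Qed.

(* A proper coloring of the square of G colors the edge vw by the unordered pair
   of the colors of v and w. *)
Lemma matching_decomposition (V : finType) (G : sgraph V) (d : nat) :
  max_degree G <= d ->
  exists2 M : {set 'I_(d.+1 * d.+1).+1} -> sgraph V,
    forall S, max_degree (M S) <= 1 &
    forall v w, adj G v w = [exists S, adj (M S) v w].
Proof.
move=> /max_degree_leP le_d.
(* Since [N] is reflexive, its square relates all vertices at distance at most 2. *)
pose N v w := (v == w) || adj G v w.
have N_sym : symmetric N by move=> v w; rewrite /N eq_sym adj_sym.
have leN v : #|[set w | N v w]| <= d.+1.
  rewrite (_ : [set w | N v w] = v |: [set w | adj G v w]); last first.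
    by apply/setP => w; rewrite !inE eq_sym.
  by rewrite cardsU1 -add1n leq_add ?le_d // leq_b1.
pose N2 v w := [exists z, N v z && N z w].
have N2_sym : symmetric N2.
  by move=> v w; apply: eq_existsb => z; rewrite andbC N_sym (N_sym v).
have leN2 v : #|[set w | N2 v w]| <= d.+1 * d.+1.
  have -> : [set w | N2 v w] = \bigcup_(z in [set z | N v z]) [set w | N z w].
    apply/setP => w; rewrite inE; apply/existsP/bigcupP => [[z /andP[vz zw]]|[z]].
      by exists z; rewrite inE.
    by rewrite !inE => vz zw; exists z; rewrite vz.
  apply: (@leq_trans (\sum_(z in [set z | N v z]) d.+1)).
    elim/big_rec2: _ => [|z m A _ le_m]; first by rewrite cards0.
    exact: leq_trans (leq_card_setU _ _) (leq_add (leN z) le_m).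
  by rewrite sum_nat_const leq_mul2r leN orbT.
have [kappa Hk] := greedy_coloring N2_sym leN2.
pose m S v w := adj G v w && ([set kappa v; kappa w] == S).
have m_sym S : symmetric (m S) by move=> v w; rewrite /m adj_sym setUC.
have m_irr S : irreflexive (m S) by move=> v; rewrite /m adj_irr.
exists (fun S => SGraph (m_sym S) (m_irr S)) => [S|v w]; last first.
  apply/idP/existsP => /= [vw|[S /andP[]] //].
  by exists [set kappa v; kappa w]; rewrite /m vw eqxx.
apply/max_degree_leP => v; apply/card_le1_eqP => w w'; rewrite !inE /= /m.
move=> /andP[vw /eqP Sw] /andP[vw' /eqP Sw'].
apply/eqP; apply: contraT => ww'.
have kww' : kappa w != kappa w'.
  apply: (Hk w w'); last by rewrite eq_sym.
  rewrite /N2; apply/existsP; exists v.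
  by rewrite /N (adj_sym G w) vw vw' !orbT.
have kvw : kappa v != kappa w.
  apply: (Hk v w); first by rewrite /N2; apply/existsP; exists v; rewrite /N vw eqxx orbT.
  by apply: contraTneq vw => ->; rewrite adj_irr.
have : kappa w \in [set kappa v; kappa w'] by rewrite Sw' -Sw !inE eqxx orbT.
by rewrite !inE (negbTE kww') eq_sym (negbTE kvw).
Qed.

(** * Types of tuples *)

Section Types.

Variable U : finType.

(** Equality of atomic types: colors act as unary predicates and the graphs of the maps [g u] as
    binary relations. The case [i = j] compares fixed points. *)
Definition same_type (T J : finType) (t : U -> T) (g : J -> U -> U) n
    (e e' : n.-tuple U) : Prop :=
  (forall i, t (tnth e i) = t (tnth e' i)) /\
  (forall u i j, (g u (tnth e i) == tnth e j) = (g u (tnth e' i) == tnth e' j)).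

Lemma same_type_sym (T J : finType) (t : U -> T) (g : J -> U -> U) n
    (e e' : n.-tuple U) : same_type t g e e' -> same_type t g e' e.
Proof. by case=> Ht Hg; split=> [i|u i j]; rewrite ?Ht ?Hg. Qed.

Definition has_inverses (J : Type) (g : J -> U -> U) (inv : J -> J) : Prop :=
  forall u x y, (g u x == y) = (g (inv u) y == x).

Definition loop_color (T J : finType) (t : U -> T) (g : J -> U -> U) (x : U) :
  T * {ffun J -> bool} := (t x, [ffun u => g u x == x]).

(** Records the neighborhood of [x] one level deeper, which pays for one quantifier. *)
Definition next_color (T J : finType) (t : U -> T) (g : J -> U -> U) (x : U) :
  {ffun J -> T * {ffun J -> bool}} := [ffun w => loop_color t g (g w x)].

Definition next_fun (J : Type) (g : J -> U -> U) (u : J * J) (x : U) : U :=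
  g u.1 (g u.2 x).

Section BackAndForth.

Variables (T J : finType) (t : U -> T) (g : J -> U -> U) (inv : J -> J) (one : J).
Hypotheses (gV : has_inverses g inv) (g1 : forall x, g one x = x).

Lemma same_type_next n (e e' : n.-tuple U) :
  same_type (next_color t g) (next_fun g) e e' -> same_type t g e e'.
Proof.
case=> Ht Hg; split=> [i|u i j].
  by have /ffunP /(_ one) := Ht i; rewrite !ffunE !g1 => -[].
by have := Hg (u, one) i j; rewrite /next_fun /= !g1.
Qed.

(* An element of the form g w e_i is answered by g w e'_i.  An element a away from
   e is answered by counting: the color class of a meets {g w e_i} and {g w e'_i}
   in equally many elements, so it is not covered by the latter set either. *)
Lemma same_type_extend n (e e' : n.-tuple U) (a : U) :
  same_type (next_color t g) (next_fun g) e e' ->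
  exists a', same_type t g [tuple of a :: e] [tuple of a' :: e'].
Proof.
move=> Hnext; have [Ht Hg] := same_type_next Hnext; case: Hnext => Ht' Hg'.
have Hc w i : loop_color t g (g w (tnth e i)) = loop_color t g (g w (tnth e' i)).
  by have /ffunP /(_ w) := Ht' i; rewrite !ffunE.
have Hgg u w i j : (g u (g w (tnth e i)) == tnth e j) =
    (g u (g w (tnth e' i)) == tnth e' j) by exact: (Hg' (u, w)).
(* Inverting [g w] reduces the comparison to a word of two maps. *)
have Hg2 u w i j : (g u (tnth e i) == g w (tnth e j)) =
    (g u (tnth e' i) == g w (tnth e' j)).
  by rewrite eq_sym gV Hgg -gV eq_sym.
suff [a' [Ha Hl Hr]] : exists a', [/\ loop_color t g a = loop_color t g a',
    forall u j, (g u a == tnth e j) = (g u a' == tnth e' j) &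
    forall u j, (g u (tnth e j) == a) = (g u (tnth e' j) == a')].
  case: Ha => Hta /ffunP Hloop; exists a'; split=> [i|u i j].
    by case: (unliftP ord0 i) => [i'|] ->; rewrite ?tnthS ?tnth0.
  case: (unliftP ord0 i) => [i'|] ->; case: (unliftP ord0 j) => [j'|] ->;
    rewrite ?tnthS ?tnth0 //.
  by have := Hloop u; rewrite !ffunE.
have [/existsP[[w i] /= /eqP Ea]|far] :=
    boolP [exists p : J * 'I_n, g p.1 (tnth e p.2) == a].
  by rewrite -Ea; exists (g w (tnth e' i)); split=> [|u j|u j]; rewrite ?Hc ?Hgg ?Hg2.
pose D := [set p : J * 'I_n | loop_color t g (g p.1 (tnth e p.2)) ==
                              loop_color t g a].
pose C := [set x | loop_color t g x == loop_color t g a].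
pose h (e0 : n.-tuple U) (p : J * 'I_n) := g p.1 (tnth e0 p.2).
have Dcard : #|h e @: D| = #|h e' @: D|.
  by apply: card_imset_same_kernel => x y; exact: Hg2.
have ltC : #|h e' @: D| < #|C|.
  rewrite -Dcard; apply/proper_card/properP; split.
    by apply/subsetP => x /imsetP[p]; rewrite inE => Dp ->; rewrite inE.
  exists a; first by rewrite inE.
  apply/imsetP => -[p _ Ep]; case/negP: far.
  by apply/existsP; exists p; rewrite [X in _ == X]Ep.
have /subsetPn[a' Ca' Na'] : ~~ (C \subset h e' @: D).
  by apply: contraL ltC => /subset_leq_card; rewrite -leqNgt.
rewrite inE in Ca'.
have farr u j : (g u (tnth e j) == a) = false.
  by apply: contraNF far => ?; apply/existsP; exists (u, j).
(* If [a'] were [g u e'_j], its color, which is that of [a], would put [(u, j)] in [D] and [a'] in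
   the image it avoids. *)
have farr' u j : (g u (tnth e' j) == a') = false.
  apply: contraNF Na' => /eqP Ea'; apply/imsetP; exists (u, j) => //.
  by rewrite inE /= Hc Ea'.
exists a'; split=> [|u j|u j]; last by rewrite farr farr'.
  by rewrite (eqP Ca').
by rewrite !(gV u) farr farr'.
Qed.

End BackAndForth.

Variables (T0 J0 : finType) (t0 : U -> T0) (g0 : J0 -> U -> U).
Variables (inv0 : J0 -> J0) (one0 : J0).
Hypotheses (g0V : has_inverses g0 inv0) (g01 : forall x, g0 one0 x = x).

(** Each level doubles the length of words: level [q] indexes words of [2 ^ q] base maps. *)
Fixpoint index_type (J : finType) (q : nat) : finType :=
  if q is q'.+1 then (index_type J q' * index_type J q')%type else J.

(** Built from [T] and [J] alone, so the palette is the same for all structures. *)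
Fixpoint color_type (T J : finType) (q : nat) : finType :=
  if q is q'.+1 then
    {ffun index_type J q' -> color_type T J q' * {ffun index_type J q' -> bool}}
  else T.

Fixpoint level_fun (q : nat) : index_type J0 q -> U -> U :=
  match q with
  | 0 => g0
  | q'.+1 => next_fun (@level_fun q')
  end.

Fixpoint level_color (q : nat) : U -> color_type T0 J0 q :=
  match q with
  | 0 => t0
  | q'.+1 => next_color (@level_color q') (@level_fun q')
  end.

Fixpoint level_inv (q : nat) : index_type J0 q -> index_type J0 q :=
  match q with
  | 0 => inv0
  | q'.+1 => fun u => (level_inv u.2, level_inv u.1)
  end.

Fixpoint level_one (q : nat) : index_type J0 q :=
  match q with
  | 0 => one0
  | q'.+1 => (level_one q', level_one q')
  end.

Lemma level_funV q : has_inverses (@level_fun q) (@level_inv q).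
Proof.
by elim: q => [|q IHq] //= u x y; rewrite /next_fun /= IHq [LHS]eq_sym IHq.
Qed.

Lemma level_fun1 q x : level_fun (level_one q) x = x.
Proof. by elim: q => [|q IHq] //=; rewrite /next_fun !IHq. Qed.

Lemma same_type_base q n (e e' : n.-tuple U) :
  same_type (@level_color q) (@level_fun q) e e' -> same_type t0 g0 e e'.
Proof.
elim: q => [|q IHq] //= Hq; apply: IHq.
exact: same_type_next (@level_fun1 q) _ _ _ Hq.
Qed.

End Types.


(** * Locality of first-order formulas *)

Fixpoint quantifier_rank (c m n : nat) (f : fo c m n) : nat :=
  match f with
  | FNot _ g => quantifier_rank g
  | FAnd _ g h => maxn (quantifier_rank g) (quantifier_rank h)
  | FEx _ g => (quantifier_rank g).+1
  | _ => 0
  end.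

Section Locality.

Variables (c m : nat) (V : finType) (G : sgraph V) (P : 'I_m -> {set V * 'I_c}).
Variables (I : finType) (M : I -> sgraph V).
Hypotheses (M1 : forall S, max_degree (M S) <= 1).
Hypotheses (GM : forall v w, adj G v w = [exists S, adj (M S) v w]).

Let U := (V * 'I_c)%type.

(** Turns a matching into an involution. Unmatched vertices are fixed, so adjacency can be read off
    at distinct vertices only. *)
Definition partner (S : I) (v : V) : V := odflt v [pick w | adj (M S) v w].

Lemma partnerP S v w : v != w -> (partner S v == w) = adj (M S) v w.
Proof.
rewrite /partner; case: pickP => [w' vw'|Hv] /= nvw; last first.
  by rewrite Hv (negbTE nvw).
apply/eqP/idP => [<- //|vw]; exact: degree_le1_inj (M1 S) vw' vw.
Qed.

Definition copy_color (x : U) : 'I_c * {ffun 'I_m -> bool} :=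
  (x.2, [ffun p => x \in P p]).

(** Permutations of the copy numbers are transitive on the copies of a vertex, which expresses the
    same-vertex relation. The identity serves as the empty word. *)
Definition copy_fun (u : I + {perm 'I_c}) (x : U) : U :=
  match u with
  | inl k => (partner k x.1, x.2)
  | inr s => (x.1, s x.2)
  end.

Definition copy_inv (u : I + {perm 'I_c}) : I + {perm 'I_c} :=
  match u with
  | inl k => inl k
  | inr s => inr s^-1%g
  end.

Lemma copy_funV : has_inverses copy_fun copy_inv.
Proof.
move=> [S|s] [v i] [w j]; rewrite /= !xpair_eqE /=; last first.
  by rewrite eq_sym; congr andb; apply/eqP/eqP => <-; rewrite ?permK ?permKV.
rewrite (eq_sym i); congr andb.
have [->|nvw] := eqVneq v w; first by [].
by rewrite !partnerP // 1?eq_sym // adj_sym.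
Qed.

Lemma copy_fun1 x : copy_fun (inr 1%g) x = x.
Proof. by case: x => v i; rewrite /= perm1. Qed.

Lemma copy_adjE (x y : U) :
  (x.2 == y.2) && adj G x.1 y.1 =
  (x != y) && [exists S, copy_fun (inl S) x == y].
Proof.
case: x y => [v i] [w j] /=.
have [->|nij] := eqVneq i j; last first.
  rewrite /=; apply/esym/andP => -[_ /existsP[S]].
  by rewrite xpair_eqE (negbTE nij) andbF.
rewrite xpair_eqE eqxx andbT /=.
have [->|nvw] /= := eqVneq v w; first by rewrite adj_irr.
by rewrite GM; apply: eq_existsb => S; rewrite xpair_eqE eqxx andbT partnerP.
Qed.

Lemma copy_sameE (x y : U) :
  (x.1 == y.1) = [exists s, copy_fun (inr s) x == y].
Proof.
apply/eqP/existsP => [Exy|[s /eqP <-] //]; exists (tperm x.2 y.2).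
by rewrite /= tpermL Exy -surjective_pairing.
Qed.

(** Induction on the formula: each quantifier spends one level through [same_type_extend], and atoms
    need only the base level, which every level refines. *)
Lemma sat_same_type n (f : fo c m n) q (e e' : n.-tuple U) :
  quantifier_rank f <= q ->
  same_type (@level_color U _ _ copy_color copy_fun q) (@level_fun U _ copy_fun q) e e' ->
  sat G P f e = sat G P f e'.
Proof.
have base k p (a a' : k.-tuple U) :
    same_type (@level_color U _ _ copy_color copy_fun p) (@level_fun U _ copy_fun p) a a' ->
    same_type copy_color copy_fun a a'.
  exact: same_type_base copy_fun1 _ _ _ _.
have eqE k (a a' : k.-tuple U) : same_type copy_color copy_fun a a' ->
    forall x y, (tnth a x == tnth a y) = (tnth a' x == tnth a' y).
  by case=> _ Hg x y; have := Hg (inr 1%g) x y; rewrite !copy_fun1.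
elim: f q e e' => {n} [n x y|n x y|n x y|n i x|n p x|n f IHf|n f IHf h IHh|n f IHf]
  q e e' /= rk_q Hee'.
- exact: eqE (base _ _ _ _ Hee') x y.
- have [Ht Hg] := base _ _ _ _ Hee'; rewrite !copy_adjE (eqE _ _ _ (base _ _ _ _ Hee')).
  by congr andb; apply: eq_existsb => S; exact: Hg.
- have [Ht Hg] := base _ _ _ _ Hee'; rewrite !copy_sameE.
  by apply: eq_existsb => s; exact: Hg.
- by have [/(_ x)[-> _] _] := base _ _ _ _ Hee'.
- have [/(_ x)[_ /ffunP/(_ p) Hp] _] := base _ _ _ _ Hee'.
  by rewrite !ffunE in Hp.
- by rewrite (IHf q e e').
- move: rk_q; rewrite geq_max => /andP[rkf rkh].
  by rewrite (IHf q e e') // (IHh q e e').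
- case: q rk_q Hee' => [|q] //; rewrite ltnS => rk_q Hee'.
  have step (a a' : n.-tuple U) :
      same_type (@level_color U _ _ copy_color copy_fun q.+1)
        (@level_fun U _ copy_fun q.+1) a a' ->
      [exists x, sat G P f [tuple of x :: a]] ->
      [exists x, sat G P f [tuple of x :: a']].
    move=> Haa' /existsP[x Hx].
    have [x' Hx'] := same_type_extend (level_funV copy_funV (q := q))
      (level_fun1 copy_fun1 q) x Haa'.
    by apply/existsP; exists x'; rewrite -(IHf q _ _ rk_q Hx').
  by apply/idP/idP; apply: step => //; exact: same_type_sym.
Qed.

End Locality.

(** * From transductions to boolean functions *)

Lemma boolean_function_of_fintype (V I : finType) (G : sgraph V) (H : I -> sgraph V)
    (f : {ffun I -> bool} -> bool) :
  (forall a b, a != b -> adj G a b = f [ffun i => adj (H i) a b]) ->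
  boolean_function_of G (fun k : 'I_#|I| => H (enum_val k)).
Proof.
move=> Gf; exists (fun v => f [ffun i => v (enum_rank i)]) => a b nab.
by rewrite Gf //; congr f; apply/ffunP => i; rewrite !ffunE enum_rankK.
Qed.

(* G is the symmetric difference of a graph that depends on the two colors only and
   of a subgraph of B.  The cliques on the unions of color classes recover the
   unordered pair of colors of two distinct vertices. *)
Lemma colored_boolean_function (V T : finType) (d : nat) (G B : sgraph V)
    (chi : V -> T) :
  max_degree B <= d ->
  (forall a b a' b', a != b -> ~~ adj B a b -> a' != b' -> ~~ adj B a' b' ->
     chi a = chi a' -> chi b = chi b' -> adj G a b = adj G a' b') ->
  exists2 H : 'I_#|{: {set T} + {set 'I_(d.+1 * d.+1).+1}}| -> sgraph V,
    forall i, familyU classC classD1 (H i) & boolean_function_of G H.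
Proof.
move=> /max_degree_leP le_d far_chi.
pose F s s' := [exists a, exists b,
  [&& a != b, ~~ adj B a b, chi a == s, chi b == s' & adj G a b]].
have F_sym : symmetric F.
  suff F_imp s s' : F s s' -> F s' s by move=> s s'; apply/idP/idP; exact: F_imp.
  move=> /existsP[a /existsP[b /and5P[nab Bab sa sb Gab]]].
  apply/existsP; exists b; apply/existsP; exists a.
  by rewrite eq_sym nab adj_sym Bab sa sb adj_sym Gab.
have FE a b : a != b -> ~~ adj B a b -> F (chi a) (chi b) = adj G a b.
  move=> nab Bab; apply/existsP/idP => [[a' /existsP[b']]|Gab].
    case/and5P=> nab' Bab' /eqP Ea /eqP Eb Gab'.
    by rewrite (far_chi a b a' b').
  by exists a; apply/existsP; exists b; rewrite nab Bab !eqxx Gab.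
pose E a b := (a != b) && (F (chi a) (chi b) (+) adj G a b).
have E_sym : symmetric E by move=> a b; rewrite /E eq_sym F_sym adj_sym.
have E_irr : irreflexive E by move=> a; rewrite /E eqxx.
have [|M M1 EM] := @matching_decomposition V (SGraph E_sym E_irr) d.
  apply/max_degree_leP => v; apply: leq_trans (le_d v).
  apply/subset_leq_card/subsetP => w; rewrite !inE /= /E => /andP[nvw].
  by apply: contraLR => Bvw; rewrite FE // addbb.
pose K (S : {set T}) a b := [&& a != b, chi a \in S & chi b \in S].
have K_sym S : symmetric (K S).
  by move=> a b; rewrite /K eq_sym; congr andb; rewrite andbC.
have K_irr S : irreflexive (K S) by move=> a; rewrite /K eqxx.
pose H (i : {set T} + {set 'I_(d.+1 * d.+1).+1}) :=
  match i with inl A => SGraph (K_sym A) (K_irr A) | inr A => M A end.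
(* The first summand decodes the color pair from the cliques; the second corrects it by the
   matchings. *)
pose f (v : {ffun {set T} + {set 'I_(d.+1 * d.+1).+1} -> bool}) :=
  [exists s, exists s', F s s' &&
     [forall A, v (inl A) == (s \in A) && (s' \in A)]] (+)
  [exists A, v (inr A)].
exists (fun i => H (enum_val i)) => [i|].
  case: (enum_val i) => A; last by right; exact: M1.
  by left; exists [set a | chi a \in A] => a b; rewrite /= /K !inE.
apply: (@boolean_function_of_fintype _ _ _ _ f) => a b nab; rewrite /f.
have -> : [exists A, [ffun i => adj (H i) a b] (inr A)] =
    F (chi a) (chi b) (+) adj G a b.
  rewrite -[RHS]/(true && _) -nab; rewrite -[RHS]/(adj (SGraph E_sym E_irr) a b) EM.
  by apply: eq_existsb => A; rewrite ffunE.
rewrite addbA (_ : [exists s, _] = F (chi a) (chi b)) ?addbb //.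
apply/existsP/idP => [[s /existsP[s' /andP[Fss /forallP Hss]]]|Fab]; last first.
  exists (chi a); apply/existsP; exists (chi b); rewrite Fab.
  by apply/forallP => A; rewrite ffunE /= /K nab.
have HA (A : {set T}) : (chi a \in A) && (chi b \in A) = (s \in A) && (s' \in A).
  by have /eqP := Hss A; rewrite ffunE /= /K nab.
(* These two test sets force [s, s'] and [chi a, chi b] to be the same unordered pair; the order is
   harmless because [F] is symmetric. *)
have := HA [set s; s']; have := HA [set chi a; chi b].
rewrite !inE !eqxx !orbT /= => /esym/andP[sab s'ab] /andP[asab bsab].
case/orP: sab asab bsab Fss => /eqP->; case/orP: s'ab => /eqP-> //.
- by rewrite !orbb => _ /eqP->.
- by rewrite F_sym.
- by rewrite !orbb => /eqP->.
Qed.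

Lemma function_of_structurally_bounded (X : graph_family) :
  structurally_bounded_degree X -> function_of X (familyU classC classD1).
Proof.
case=> Y [_ [d Yd] [c [m [phi XY]]]].
pose q := quantifier_rank phi.
pose J0 := ({set 'I_(d.+1 * d.+1).+1} + {perm 'I_c})%type.
pose J := index_type J0 q.
pose T := (color_type ('I_c * {ffun 'I_m -> bool})%type J0 q * {ffun J -> bool})%type.
(* This bound depends on [d], [c], [m] and [phi] only. *)
exists #|{: {set T} + {set 'I_(#|J|.+1 * #|J|.+1).+1}}| => W G' XG'.
have [V [G [P [H [YG HE [f f_inj G'f]]]]]] := XY W G' XG'.
have [M M1 GM] := matching_decomposition (Yd _ _ YG).
pose g := @level_fun _ _ (@copy_fun c V _ M) q.
pose t := @level_color _ _ _ (copy_color P) (@copy_fun c V _ M) q.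
have gV := level_funV (@copy_funV c V _ M M1) (q := q); rewrite -/g in gV.
(* Near pairs, linked by a word: at most [#|J|] at each vertex. *)
pose N a b := (a != b) && [exists u, g u (f a) == f b].
have N_sym : symmetric N.
  suff N_imp a b : N a b -> N b a by move=> a b; apply/idP/idP; exact: N_imp.
  rewrite /N eq_sym => /andP[-> /existsP[u]]; rewrite gV => gba.
  by apply/existsP; exists (level_inv (@copy_inv c _) u).
have N_irr : irreflexive N by move=> a; rewrite /N eqxx.
eexists; first exact: leqnn.
apply: (@colored_boolean_function W T #|J| G' (SGraph N_sym N_irr)
          (fun a => loop_color t g (f a))).
  apply/max_degree_leP => a; rewrite /degree -(card_imset _ f_inj).
  apply: leq_trans (leq_imset_card (fun u => g u (f a)) J).
  apply/subset_leq_card/subsetP => x /imsetP[b]; rewrite inE /= => /andP[_].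
  by case/existsP=> u /eqP <- ->; exact: imset_f.
move=> a b a' b' nab /= Nab nab' Nab' Ea Eb; rewrite !G'f !HE.
have far x y u : x != y -> ~~ N x y -> (g u (f x) == f y) = false.
  by move=> nxy; rewrite /N nxy; apply: contraNF => gxy; apply/existsP; exists u.
have Nba : ~~ N b a by rewrite N_sym.
have Nba' : ~~ N b' a' by rewrite N_sym.
have nba : b != a by rewrite eq_sym.
have nba' : b' != a' by rewrite eq_sym.
case: Ea Eb => Ea /ffunP Sa [Eb /ffunP Sb].
(* For a pair that is not near, the loop colors give the colors and the diagonal entries of the
   type, and all off-diagonal entries are false. *)
apply: (sat_same_type M1 GM (leqnn q)); split=> [i|u i j].
  by case: (unliftP ord0 i) => [i'|] ->; rewrite ?tnthS ?tnth0 // (ord1 i').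
case: (unliftP ord0 i) => [i'|] ->; case: (unliftP ord0 j) => [j'|] ->;
  rewrite ?tnthS ?tnth0 ?(ord1 i') ?(ord1 j') ?tnth0 -/(g u).
- by have := Sb u; rewrite !ffunE.
- by rewrite !far.
- by rewrite !far.
- by have := Sa u; rewrite !ffunE.
Qed.

(** * From boolean functions to transductions *)

Section Connectives.

Variables (c m n : nat).
Implicit Types f g : fo c m n.

Definition FOr f g : fo c m n := FNot (FAnd (FNot f) (FNot g)).
Definition FIff (b : bool) f : fo c m n := if b then f else FNot f.
Definition FBigAnd (I : finType) (f0 : fo c m n) (f : I -> fo c m n) : fo c m n :=
  foldr (fun i => FAnd (f i)) f0 (enum I).
Definition FBigOr (I : finType) (f0 : fo c m n) (f : I -> fo c m n) : fo c m n :=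
  foldr (fun i => FOr (f i)) f0 (enum I).

Variables (V : finType) (G : sgraph V) (P : 'I_m -> {set V * 'I_c}).
Variable e : n.-tuple (V * 'I_c)%type.

Lemma sat_FOr f g : sat G P (FOr f g) e = sat G P f e || sat G P g e.
Proof. by rewrite /= negb_and !negbK. Qed.

Lemma sat_FIff b f : sat G P (FIff b f) e = (sat G P f e == b).
Proof. by case: b => /=; [rewrite eqb_id | rewrite eqbF_neg]. Qed.

Lemma sat_FBigAnd (I : finType) f0 (f : I -> fo c m n) : sat G P f0 e ->
  sat G P (FBigAnd f0 f) e = [forall i, sat G P (f i) e].
Proof.
move=> sat0; rewrite /FBigAnd; transitivity (all (fun i => sat G P (f i) e) (enum I)).
  by elim: (enum I) => [|i r IHr] //=; rewrite IHr.
by apply/allP/forallP => [H i|H i _]; apply: H; rewrite mem_enum.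
Qed.

Lemma sat_FBigOr (I : finType) f0 (f : I -> fo c m n) : ~~ sat G P f0 e ->
  sat G P (FBigOr f0 f) e = [exists i, sat G P (f i) e].
Proof.
move=> sat0; transitivity (has (fun i => sat G P (f i) e) (enum I)).
  rewrite /FBigOr; elim: (enum I) => [|i r IHr]; first exact: negbTE.
  by rewrite [foldr _ _ _]/= sat_FOr IHr.
by apply/hasP/existsP => [[i _ Hi]|[i Hi]]; exists i; rewrite ?mem_enum.
Qed.

End Connectives.

Definition empty_graph (V : finType) : sgraph V :=
  @SGraph V (fun _ _ => false) (fun _ _ => erefl) (fun _ => erefl).

Lemma classC_empty (V : finType) : classC (empty_graph V).
Proof. by exists set0 => u v; rewrite inE andbF. Qed.

Lemma classD1_empty (V : finType) : classD1 (empty_graph V).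
Proof.
by apply/max_degree_leP => v; rewrite /degree (_ : [set _ | _] = set0) ?cards0 //;
  apply/setP => w; rewrite !inE.
Qed.

(** A transduction has one formula while the number of graphs may vary, so the family is filled up
    with empty graphs. *)
Lemma boolean_function_of_pad (X : graph_family) (V : finType) (G : sgraph V) l k
    (H : 'I_l -> sgraph V) :
  l <= k -> X V (empty_graph V) -> (forall i, X V (H i)) ->
  boolean_function_of G H ->
  exists2 H' : 'I_k -> sgraph V, forall i, X V (H' i) & boolean_function_of G H'.
Proof.
move=> le_lk X0 XH [f Gf].
exists (fun i => oapp H (empty_graph V) (insub (val i))) => [i|].
  by case: insub.
exists (fun v => f [ffun i => v (widen_ord le_lk i)]) => a b nab.
rewrite Gf //; congr f; apply/ffunP => i; rewrite !ffunE /=.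
by rewrite insubT //= => lt_i; congr (adj (H _) _ _); exact: val_inj.
Qed.

(* In the source graph, the vertex (v, None) stands for v and is joined to the copies
   (v, Some i), which carry the i-th matching.  The colors mark the layers, the
   cliques, and the truth table of the boolean function, which depends on the graph
   although the formula may not. *)
Section Source.

Variables (k : nat) (V : finType) (M : 'I_k -> sgraph V).

Definition source_adj (x y : V * option 'I_k) : bool :=
  match x.2, y.2 with
  | None, Some _ | Some _, None => x.1 == y.1
  | Some i, Some j => (i == j) && adj (M i) x.1 y.1
  | None, None => false
  end.

Lemma source_adj_sym : symmetric source_adj.
Proof.
move=> [v [i|]] [w [j|]]; rewrite /source_adj //= eq_sym //.
by have [->|//] := eqVneq; rewrite adj_sym.
Qed.

Lemma source_adj_irr : irreflexive source_adj.
Proof. by move=> [v [i|]]; rewrite /source_adj //= adj_irr andbF. Qed.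

Definition source_graph : sgraph (V * option 'I_k)%type :=
  SGraph source_adj_sym source_adj_irr.

(** A layer vertex sees its base vertex and at most one partner, a base vertex its [k] layer
    vertices; [k.+2] is a crude common bound. *)
Lemma source_max_degree : (forall i, max_degree (M i) <= 1) ->
  max_degree source_graph <= k.+2.
Proof.
move=> M1; apply/max_degree_leP => -[v [i|]].
  have /max_degree_leP/(_ v) le1 := M1 i.
  rewrite (_ : degree _ _ = #|(v, None) |: [set (w, Some i) | w in
    [set w | adj (M i) v w]]|); last first.
    apply: eq_card => -[w [j|]]; rewrite !inE /= /source_adj /= xpair_eqE /=; last first.
      rewrite andbT eq_sym; case: eqP => //= _.
      by apply/esym/imsetP => -[].
    rewrite andbF /=; apply/andP/imsetP => [[/eqP<- vw]|[w']].
      by exists w; rewrite ?inE.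
    by rewrite inE => vw [-> ->].
  apply: leq_trans (_ : 1 + 1 <= _) => //.
  by rewrite cardsU1 leq_add ?leq_b1 // (leq_trans (leq_imset_card _ _)).
apply: (@leq_trans #|[set (v, Some i) | i : 'I_k]|).
  apply/subset_leq_card/subsetP => -[w [j|]]; rewrite !inE /= /source_adj //=.
  by move/eqP=> <-; exact: imset_f.
apply: leq_trans (leq_imset_card _ _) _.
by rewrite card_ord; apply: leq_trans (leqnSn _) (leqnSn _).
Qed.

End Source.

Section Formula.

Variable k : nat.

Definition source_color : finType :=
  (option 'I_k + 'I_k + {ffun 'I_k -> bool})%type.

Let Fcol n (z : source_color) (x : 'I_n) : fo 1 #|source_color| n :=
  FColor 1 (enum_rank z) x.

(* The variables of the body are w, z, x, y, in this order. *)
Definition matching_formula (i : 'I_k) : fo 1 #|source_color| 2 :=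
  let w : 'I_4 := inord 0 in let z : 'I_4 := inord 1 in
  let x : 'I_4 := inord 2 in let y : 'I_4 := inord 3 in
  let layer := inl (inl (Some i)) in
  FEx (FEx (FAnd (FAnd (Fcol layer z) (Fcol layer w))
    (FAnd (FAdj _ _ x z) (FAnd (FAdj _ _ z w) (FAdj _ _ w y))))).

Definition edge_formula (i : 'I_k) : fo 1 #|source_color| 2 :=
  FOr (FAnd (Fcol (inl (inr i)) ord0) (Fcol (inl (inr i)) ord_max))
      (matching_formula i).

(** One disjunct per row [s] of the truth table: a color given to all vertices or to none tells
    whether [f s] holds. *)
Definition function_formula : fo 1 #|source_color| 2 :=
  let base x := Fcol (inl (inl None)) x in
  let true_formula := FEq _ _ ord0 ord0 in
  FAnd (FNot (FEq _ _ ord0 ord_max)) (FAnd (FAnd (base ord0) (base ord_max))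
    (FBigOr (FNot true_formula) (fun s : {ffun 'I_k -> bool} =>
       FAnd (Fcol (inr s) ord0)
            (FBigAnd true_formula (fun i => FIff (s i) (edge_formula i)))))).

Variables (V : finType) (M : 'I_k -> sgraph V) (K : 'I_k -> {set V}).
Variable f : {ffun 'I_k -> bool} -> bool.

Definition source_coloring (p : 'I_#|source_color|) :
    {set V * option 'I_k * 'I_1} :=
  match enum_val p with
  | inl (inl o) => [set x | x.1.2 == o]
  | inl (inr i) => [set x | x.1.1 \in K i]
  | inr s => [set x | f s]
  end.

Let sat_source := sat (source_graph M) source_coloring.

(** A matching edge appears as the path [(v, None)], [(v, Some i)], [(w, Some i)], [(w, None)]. *)
Lemma sat_matching_formula i v w :
  sat_source (matching_formula i) [tuple (v, None, ord0); (w, None, ord0)] =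
  adj (M i) v w.
Proof.
rewrite /sat_source /=; apply/existsP/idP => [[[[z oz] iz] /existsP[[[z' oz'] iz']]]|vw].
  rewrite !(tnth_nth (v, None, ord0)) /= !inordK //= /source_coloring !enum_rankK !inE /=.
  case/andP=> /andP[/eqP-> /eqP->] /and3P[/andP[_ vz] /andP[_ zz'] /andP[_ zw]].
  move: vz zz' zw; rewrite /source_adj /= eqxx => /eqP-> zz' /eqP <-; exact: zz'.
exists (v, Some i, ord0); apply/existsP; exists (w, Some i, ord0).
rewrite !(tnth_nth (v, None, ord0)) /= !inordK //= /source_coloring !enum_rankK !inE /=.
by rewrite /source_adj /= !eqxx vw.
Qed.

Lemma sat_function_formula (a b : V * option 'I_k * 'I_1) :
  sat_source function_formula [tuple a; b] =
  [&& a.1.1 != b.1.1, a.1.2 == None, b.1.2 == None &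
      f [ffun i => (a.1.1 \in K i) && (b.1.1 \in K i) || adj (M i) a.1.1 b.1.1]].
Proof.
rewrite /sat_source; set e := [tuple a; b].
have e0 : tnth e ord0 = a by [].
have e1 : tnth e ord_max = b by [].
rewrite [LHS]/= e0 e1 /source_coloring !enum_rankK !inE.
case: (a.1.2 =P None) => [Ha|_]; last by rewrite !andbF.
case: (b.1.2 =P None) => [Hb|_]; last by rewrite !andbF.
have Ea : a = (a.1.1, None, ord0).
  by case: (a) Ha => [[v o] i] /= ->; rewrite (ord1 i).
have Eb : b = (b.1.1, None, ord0).
  by case: (b) Hb => [[v o] i] /= ->; rewrite (ord1 i).
have sat_edge i : sat (source_graph M) source_coloring (edge_formula i) e =
    (a.1.1 \in K i) && (b.1.1 \in K i) || adj (M i) a.1.1 b.1.1.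
  rewrite sat_FOr -sat_matching_formula -Ea -Eb [sat _ _ (FAnd _ _) _]/= e0 e1.
  by rewrite /source_coloring enum_rankK !inE.
rewrite -/source_coloring /=; congr andb.
  by rewrite Ea Eb !xpair_eqE /= !eqxx !andbT.
rewrite sat_FBigOr /= ?eqxx //; apply/existsP/idP => [[s]|fE].
  rewrite /source_coloring enum_rankK inE sat_FBigAnd /= ?eqxx //.
  case/andP=> fs /forallP Hs; rewrite (_ : [ffun _ => _] = s) //.
  apply/ffunP => i; rewrite ffunE -sat_edge; apply/eqP.
  by rewrite -sat_FIff; exact: Hs.
exists [ffun i => (a.1.1 \in K i) && (b.1.1 \in K i) || adj (M i) a.1.1 b.1.1].
rewrite /source_coloring enum_rankK inE fE sat_FBigAnd /= ?eqxx //.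
by apply/forallP => i; rewrite sat_FIff sat_edge ffunE.
Qed.

End Formula.

Lemma structurally_bounded_of_function (X : graph_family) :
  function_of X (familyU classC classD1) -> structurally_bounded_degree X.
Proof.
case=> k Xk; exists (fun V G => max_degree G <= k.+2); split.
- by move=> V W G H isoGH; exact: iso_max_degree.
- by exists k.+2.
exists 1, #|source_color k|, (function_formula k) => V G XG.
have [l le_lk [H0 H0X GH0]] := Xk V G XG.
have [|H HX [f Gf]] := boolean_function_of_pad le_lk _ H0X GH0.
  by left; exact: classC_empty.
(* Cliques and matchings take the common form of a union of a clique and a matching, one of them
   empty. *)
have HKM i : exists K : {set V}, exists2 N : sgraph V, max_degree N <= 1 &
    forall a b, a != b -> adj (H i) a b = (a \in K) && (b \in K) || adj N a b.
  case: (HX i) => [[K HK]|H1]; last first.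
    by exists set0, (H i) => // a b _; rewrite inE.
  exists K, (empty_graph V); first exact: classD1_empty.
  by move=> a b nab; rewrite HK nab orbF.
have [K {}HKM] := fin_all_exists HKM.
have [M M1 HE] := fin_all_exists2 HKM.
(* The transduced graph is [G] on the base vertices, with the layer vertices isolated. *)
pose R (a b : V * option 'I_k * 'I_1) :=
  [&& a.1.2 == None, b.1.2 == None & adj G a.1.1 b.1.1].
have R_sym : symmetric R by move=> a b; rewrite /R andbCA adj_sym.
have R_irr : irreflexive R by move=> a; rewrite /R adj_irr !andbF.
exists (V * option 'I_k)%type, (source_graph M), (source_coloring K f), (SGraph R_sym R_irr).
split; first exact: source_max_degree.
  move=> a b; rewrite sat_function_formula /= /R.
  have [->|nab] := eqVneq a.1.1 b.1.1; first by rewrite adj_irr !andbF.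
  by rewrite Gf //; do 2!congr andb; congr f; apply/ffunP => i; rewrite !ffunE HE.
exists (fun v => (v, None, ord0)) => [u v []|u v] //.
Qed.

Theorem theorem4p21 (X : graph_family) (hX : iso_closed X) :
  structurally_bounded_degree X <-> function_of X (familyU classC classD1).
Proof.
split; first exact: function_of_structurally_bounded.
exact: structurally_bounded_of_function.
Qed.
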